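(* (i) There exists a positive integer $s$ such that for all graphs $G,H$ having the $s$-extension property, if each of the sentences $\varphi^1_C,\varphi^2_C,\varphi^3_C,\varphi^1_I,\varphi^2_I,\varphi^3_I$ does not differ between $G$ and $H$ (that is, it is true on both or false on both), then no sentence $\varphi\in\mathcal{E}_1^2$ differs between $G$ and $H$. (ii) For every positive integer $s$ and every $$\varphi\in\{\varphi^1_C,\ \neg\varphi^1_C\wedge\neg\varphi^2_C\wedge\varphi^3_C,\ \neg\varphi^1_C\wedge\neg\varphi^2_C\wedge\neg\varphi^3_C,\ \varphi^2_C\wedge\varphi^3_C,\ \varphi^2_C\wedge\neg\varphi^3_C\},$$ there exists a graph $G$ with the $s$-extension property such that $G\models\varphi$; and the same holds with $\varphi^1_C,\varphi^2_C,\varphi^3_C$ replaced by $\varphi^1_I,\varphi^2_I,\varphi^3_I$ respectively.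
   Context: Graphs are finite undirected simple graphs; sentences use relations $\sim$ (adjacency) and $=$. A graph has the $s$-extension property if for every set $S$ of $s$ distinct vertices and every subset $T\subseteq S$ (possibly empty) there is a vertex $z\notin S$ adjacent to every vertex of $T$ and non-adjacent to every vertex of $S\setminus T$. $\mathcal{E}_1^2$ is the class of sentences $\exists X\,\phi(X)$ with a single monadic variable $X$ (ranging over vertex subsets) and $\phi(X)$ a first order sentence in $\sim,=,X$ of quantifier depth 2. Define formulas of a set variable $X$: $\mathrm{cl}(X)$: any two distinct vertices of $X$ are adjacent; $\max\mathrm{cl}(X)$: $\mathrm{cl}(X)$ holds and there is no vertex outside $X$ adjacent to all vertices of $X$; $\varphi_C(X)$: there is a vertex outside $X$ adjacent to no vertex of $X$; $\mathrm{ind}(X)$: no two vertices of $X$ are adjacent; $\max\mathrm{ind}(X)$: $\mathrm{ind}(X)$ holds and there is no vertex outside $X$ adjacent to no vertex of $X$; $\varphi_I(X)$: there is a vertex outside $X$ adjacent to every vertex of $X$. Then $\varphi^1_C=\forall X[\mathrm{cl}(X)\to\varphi_C(X)]$, $\varphi^2_C=\forall X[\max\mathrm{cl}(X)\to\neg\varphi_C(X)]$, $\varphi^3_C=\forall X[(\mathrm{cl}(X)\wedge\neg\varphi_C(X))\to\max\mathrm{cl}(X)]$, and $\varphi^1_I=\forall X[\mathrm{ind}(X)\to\varphi_I(X)]$, $\varphi^2_I=\forall X[\max\mathrm{ind}(X)\to\neg\varphi_I(X)]$, $\varphi^3_I=\forall X[(\mathrm{ind}(X)\wedge\neg\varphi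_I(X))\to\max\mathrm{ind}(X)]$.
   Formalization: A graph with the s-extension property is also required to have at least s vertices; otherwise smaller graphs have it vacuously and (i) fails (e.g. K_2 and K_3 for s ≥ 4 agree on all six sentences but differ on a sentence of E_1^2). Quantifier depth 2 is read as at most 2. *)

(* Defs.v *)
From HB Require Import structures.
From mathcomp Require Import all_boot.
Set Implicit Arguments. Unset Strict Implicit. Unset Printing Implicit Defensive.

Record graph := Graph {
  vertex : finType;
  adj : rel vertex;
  adj_sym : symmetric adj;
  adj_irr : irreflexive adj }.

Definition ext_prop (s : nat) (G : graph) : Prop :=
  forall (S T : {set vertex G}), #|S| = s -> T \subset S ->
    exists z : vertex G, z \notin S /\
      (forall x, x \in T -> adj z x) /\
      (forall x, x \in S :\: T -> ~~ adj z x).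

Inductive form : Type :=
  | FAdj of nat & nat
  | FEq of nat & nat
  | FIn of nat
  | FTrue | FFalse
  | FNot of form
  | FAnd of form & form
  | FOr of form & form
  | FImp of form & form
  | FEx of nat & form
  | FAll of nat & form.

Fixpoint qdepth (f : form) : nat :=
  match f with
  | FAdj _ _ | FEq _ _ | FIn _ | FTrue | FFalse => 0
  | FNot g => qdepth g
  | FAnd g h | FOr g h | FImp g h => maxn (qdepth g) (qdepth h)
  | FEx _ g | FAll _ g => (qdepth g).+1
  end.

Fixpoint vars_bound (b : seq nat) (f : form) : bool :=
  match f with
  | FAdj i j | FEq i j => (i \in b) && (j \in b)
  | FIn i => i \in b
  | FTrue | FFalse => true
  | FNot g => vars_bound b g
  | FAnd g h | FOr g h | FImp g h => vars_bound b g && vars_bound b h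
  | FEx i g | FAll i g => vars_bound (i :: b) g
  end.

Definition sentence (f : form) : bool := vars_bound [::] f.

Definition upd (V : Type) (env : nat -> option V) (i : nat) (x : V) :=
  fun k => if k == i then Some x else env k.

Fixpoint sat (G : graph) (X : {set vertex G})
    (env : nat -> option (vertex G)) (f : form) : Prop :=
  match f with
  | FAdj i j => match env i, env j with
                | Some x, Some y => adj x y | _, _ => False end
  | FEq i j => match env i, env j with
               | Some x, Some y => x = y | _, _ => False end
  | FIn i => match env i with Some x => x \in X | None => False end
  | FTrue => True
  | FFalse => False
  | FNot g => ~ sat X env g
  | FAnd g h => sat X env g /\ sat X env h
  | FOr g h => sat X env g \/ sat X env h
  | FImp g h => sat X env g -> sat X env h
  | FEx i g => exists x : vertex G, sat X (upd env i x) g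
  | FAll i g => forall x : vertex G, sat X (upd env i x) g
  end.

(* phi(X) is a first-order sentence in ~,=,X of quantifier depth (at most) 2;
   the E_1^2 sentence is  exists X, phi(X). *)
Definition E12 (phi : form) : bool := sentence phi && (qdepth phi <= 2).

Definition sat_E12 (G : graph) (phi : form) : Prop :=
  exists X : {set vertex G}, sat X (fun _ => None) phi.

Section Props.
Variable G : graph.
Implicit Types X : {set vertex G}.

Definition cl X : Prop :=
  forall x y, x \in X -> y \in X -> x != y -> adj x y.
Definition phiC X : Prop :=
  exists z, z \notin X /\ forall x, x \in X -> ~~ adj z x.
Definition maxcl X : Prop :=
  cl X /\ ~ (exists z, z \notin X /\ forall x, x \in X -> adj z x).
Definition ind X : Prop :=
  forall x y, x \in X -> y \in X -> x != y -> ~~ adj x y.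
Definition phiI X : Prop :=
  exists z, z \notin X /\ forall x, x \in X -> adj z x.
Definition maxind X : Prop :=
  ind X /\ ~ (exists z, z \notin X /\ forall x, x \in X -> ~~ adj z x).

Definition phiC1 : Prop := forall X, cl X -> phiC X.
Definition phiC2 : Prop := forall X, maxcl X -> ~ phiC X.
Definition phiC3 : Prop := forall X, cl X /\ ~ phiC X -> maxcl X.
Definition phiI1 : Prop := forall X, ind X -> phiI X.
Definition phiI2 : Prop := forall X, maxind X -> ~ phiI X.
Definition phiI3 : Prop := forall X, ind X /\ ~ phiI X -> maxind X.
End Props.

(* Non-degenerate reading: a graph "with the s-extension property" is taken to
   have at least s vertices (otherwise the property holds vacuously for every
   graph with fewer than s vertices). *)
Definition has_ext (s : nat) (G : graph) : Prop :=
  s <= #|vertex G| /\ ext_prop s G.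

(* Main.v *)
Require Import Defs.
From mathcomp Require Import all_boot zify.
Set Implicit Arguments. Unset Strict Implicit. Unset Printing Implicit Defensive.

(** (i) By a two-round Ehrenfeucht-Fraisse game, [exists X, phi(X)] only depends
on which vertex types occur, the type of x recording whether x is in X and
whether x has a neighbour, resp. a non-neighbour, in X and in its complement.
Call x clean for a set if it is adjacent to all or to none of its other
elements. The extension property forbids a vertex clean for X and another one
clean for the complement. Hence either a single vertex is clean for both, and X
is essentially its neighbourhood, or, up to exchanging X and its complement, no
vertex is clean for the complement. In the latter case X has at most one
element, or is a clique, or is independent, or else has a combination of types
that occurs in every graph with the extension property. For cliques the possible
combinations are decided by the three sentences, and independent sets are
cliques of the complement graph.

(ii) Start from a random coloured graph, in which every adjacency pattern over a
small vertex set is realized in every colour, and delete the edges inside the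
colour classes: cliques become small. This graph satisfies phi_C^1. If moreover
the colours are arranged in groups of c >= 2 and distinct classes of one group are
completely joined, then the maximal cliques are the transversals of the classes,
and they are dominating; a proper part of a transversal can be dominating iff
c >= 3. Finally, joining a clique K of more than s vertices to all vertices it
does not dominate makes K dominating, and every dominating clique contain K;
such a K is maximal iff it meets all colours. *)

(** * Reduction to vertex types *)

Section EhrenfeuchtFraisse.
Variables (G H : graph) (X : {set vertex G}) (Y : {set vertex H}).

Definition partial_iso (P : seq (vertex G * vertex H)) : Prop :=
  forall p q, p \in P -> q \in P ->
    [/\ adj p.1 q.1 = adj p.2 q.2, (p.1 == q.1) = (p.2 == q.2)
      & (p.1 \in X) = (p.2 \in Y)].

Fixpoint duplicator_wins (k : nat) (P : seq (vertex G * vertex H)) : Prop :=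
  partial_iso P /\
  if k is k'.+1 then
    (forall x, exists y, duplicator_wins k' ((x, y) :: P)) /\
    (forall y, exists x, duplicator_wins k' ((x, y) :: P))
  else True.

Lemma duplicator_wins_iso k P : duplicator_wins k P -> partial_iso P.
Proof. by case: k => [|k] []. Qed.

(** Each variable of [b] names a pair played so far, and a quantifier spends one round. Rebinding a
    variable only hides its old pair, since [b] and [P] both merely grow. *)
Lemma sat_duplicator f k P b env env' :
    duplicator_wins k P -> qdepth f <= k -> vars_bound b f ->
    (forall i, i \in b ->
      exists2 p, p \in P & env i = Some p.1 /\ env' i = Some p.2) ->
  sat X env f <-> sat Y env' f.
Proof.
elim: f k P b env env' =>
  [i j|i j|i|||g IHg|g IHg h IHh|g IHg h IHh|g IHg h IHh|i g IHg|i g IHg]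
  k P b env env' W /= dk bf Eb.
- case/andP: bf => /Eb[p pP [-> ->]] /Eb[q qP [-> ->]].
  by have [-> _ _] := duplicator_wins_iso W pP qP.
- case/andP: bf => /Eb[p pP [-> ->]] /Eb[q qP [-> ->]].
  have [_ eqE _] := duplicator_wins_iso W pP qP.
  by split=> /eqP; [rewrite eqE | rewrite -eqE] => /eqP.
- by case/Eb: bf => p pP [-> ->]; have [_ _ ->] := duplicator_wins_iso W pP pP.
- by [].
- by [].
- by have := IHg _ _ _ _ _ W dk bf Eb; tauto.
- move: dk bf; rewrite geq_max => /andP[dg dh] /andP[bg bh].
  have := IHg _ _ _ _ _ W dg bg Eb; have := IHh _ _ _ _ _ W dh bh Eb; tauto.
- move: dk bf; rewrite geq_max => /andP[dg dh] /andP[bg bh].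
  have := IHg _ _ _ _ _ W dg bg Eb; have := IHh _ _ _ _ _ W dh bh Eb; tauto.
- move: dk bf; rewrite geq_max => /andP[dg dh] /andP[bg bh].
  have := IHg _ _ _ _ _ W dg bg Eb; have := IHh _ _ _ _ _ W dh bh Eb; tauto.
- case: k W dk => // k [_ [forth back]] dk.
  have step x y (Wxy : duplicator_wins k ((x, y) :: P)) :
    sat X (upd env i x) g <-> sat Y (upd env' i y) g.
    apply: (IHg _ _ _ _ _ Wxy dk bf) => j; rewrite inE /upd.
    case: eqP => [_ _|_ /= /Eb[p pP E]]; first by exists (x, y); rewrite ?mem_head.
    by exists p; rewrite // inE pP orbT.
  split=> [[x sx]|[y sy]].
    by have [y /step[+ _]] := forth x => /(_ sx); exists y.
  by have [x /step[_ +]] := back y => /(_ sy); exists x.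
- case: k W dk => // k [_ [forth back]] dk.
  have step x y (Wxy : duplicator_wins k ((x, y) :: P)) :
    sat X (upd env i x) g <-> sat Y (upd env' i y) g.
    apply: (IHg _ _ _ _ _ Wxy dk bf) => j; rewrite inE /upd.
    case: eqP => [_ _|_ /= /Eb[p pP E]]; first by exists (x, y); rewrite ?mem_head.
    by exists p; rewrite // inE pP orbT.
  split=> [sX y|sY x].
    by have [x /step[+ _]] := back y => /(_ (sX x)).
  by have [y /step[_ +]] := forth x => /(_ (sY y)).
Qed.

End EhrenfeuchtFraisse.

Section Types.
Variable G : graph.
Implicit Types (x y z u v w : vertex G) (X Z : {set vertex G}) (a b : bool).

(** The clause [y != x] keeps [x], which is not adjacent to itself, from counting as its own
    non-neighbour. *)
Definition sees Z x a := [exists y in Z, (y != x) && (adj x y == a)].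

Definition vtype X x :=
  (x \in X, sees X x true, sees X x false,
   sees (~: X) x true, sees (~: X) x false).

Lemma seesP Z x a :
  reflect (exists y, [/\ y \in Z, y != x & adj x y = a]) (sees Z x a).
Proof.
apply: (iffP existsP) => [[y /and3P[yZ yx /eqP xy]]|[y [yZ yx xy]]].
  by exists y.
by exists y; rewrite yZ yx xy eqxx.
Qed.

Lemma sees_adj Z x y : y \in Z -> y != x -> sees Z x (adj x y).
Proof. by move=> yZ yx; apply/seesP; exists y. Qed.

End Types.

Definition similar G H (X : {set vertex G}) (Y : {set vertex H}) :=
  (forall x, exists y, vtype X x = vtype Y y) /\
  (forall y, exists x, vtype X x = vtype Y y).

(** After a first move [x], all that matters about a second move [z] different from [x] is its side
    of [X] and its adjacency to [x]. The type of [x] lists the combinations that occur. *)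
Lemma vtype_step G H (X : {set vertex G}) (Y : {set vertex H}) x y z :
  vtype X x = vtype Y y ->
  exists t, partial_iso X Y [:: (z, t); (x, y)].
Proof.
move=> [inE1 XT XF cXT cXF].
suff [t [e1 e2 e3]] : exists t, [/\ adj x z = adj y t, (z == x) = (t == y)
    & (z \in X) = (t \in Y)].
  exists t => p q; rewrite !inE => /orP[]/eqP-> /orP[]/eqP-> /=;
    rewrite ?adj_irr ?eqxx; split=> //; rewrite ?(adj_sym z) ?(adj_sym t) //.
  by rewrite eq_sym e2 eq_sym.
have [->|zx] := eqVneq z x; first by exists y; rewrite !adj_irr eqxx.
have eqX a : sees X x a = sees Y y a by case: a.
have eqC a : sees (~: X) x a = sees (~: Y) y a by case: a.
have [zX|zX] := boolP (z \in X).
  have := sees_adj zX zx; rewrite eqX => /seesP[t [tY ty yt]].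
  by exists t; rewrite yt tY (negPf ty).
have /sees_adj/(_ zx) : z \in ~: X by rewrite inE.
rewrite eqC => /seesP[t []]; rewrite inE => tY ty yt.
by exists t; rewrite yt (negPf tY) (negPf ty).
Qed.

Lemma partial_iso_sym G H (X : {set vertex G}) (Y : {set vertex H}) z t x y :
  partial_iso Y X [:: (t, z); (y, x)] -> partial_iso X Y [:: (z, t); (x, y)].
Proof.
move=> iso p q; rewrite !inE => Pp Pq.
have mem r : (r == (z, t)) || (r == (x, y)) ->
  (r.2, r.1) \in [:: (t, z); (y, x)].
  by rewrite !inE => /orP[]/eqP->; rewrite eqxx ?orbT.
by have [/= -> -> ->] := iso _ _ (mem _ Pp) (mem _ Pq).
Qed.

Lemma similar_sat G H (X : {set vertex G}) (Y : {set vertex H}) phi :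
  E12 phi -> similar X Y -> sat X (fun=> None) phi <-> sat Y (fun=> None) phi.
Proof.
move=> /andP[sphi dphi] [forth back].
apply: (@sat_duplicator G H X Y phi 2 [::] [::]) => //.
have base x y (e : vtype X x = vtype Y y) : duplicator_wins X Y 1 [:: (x, y)].
  split; last first.
    split=> [z|t]; first by have [t ?] := vtype_step z e; exists t.
    by have [z ?] := vtype_step t (esym e); exists z; split=> //; apply: partial_iso_sym.
  (* The one-pair position is a part of any two-pair position, here the one after replaying [x]. *)
  have [t iso] := vtype_step x e.
  by move=> p q Pp Pq; apply: iso; rewrite inE ?Pp ?Pq orbT.
split=> //; split=> [x|y].
  by have [y e] := forth x; exists y; apply: base.
by have [x e] := back y; exists x; apply: base.
Qed.

Lemma similar_setC G H (X : {set vertex G}) (Y : {set vertex H}) :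
  similar (~: X) (~: Y) -> similar X Y.
Proof.
have E x y : vtype (~: X) x = vtype (~: Y) y -> vtype X x = vtype Y y.
  rewrite /vtype !setCK !in_setC => -[e1 e2 e3 e4 e5].
  by congr (_, _, _, _, _) => //; apply: negb_inj.
move=> [forth back]; split=> [x|y].
  by have [y e] := forth x; exists y; apply: E.
by have [x e] := back y; exists x; apply: E.
Qed.

(** * Complement graphs *)

Section Complement.
Variable G : graph.

Definition coadj : rel (vertex G) := fun x y => (x != y) && ~~ adj x y.
Lemma coadj_sym : symmetric coadj.
Proof. by move=> x y; rewrite /coadj eq_sym adj_sym. Qed.
Lemma coadj_irr : irreflexive coadj.
Proof. by move=> x; rewrite /coadj eqxx. Qed.
Definition complement := Graph coadj_sym coadj_irr.

Lemma coadjE (x y : vertex complement) : x != y -> adj x y = ~~ adj (x : vertex G) y.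
Proof. by rewrite /= /coadj => ->. Qed.

Lemma complement_ext s : has_ext s G -> has_ext s complement.
Proof.
move=> [leG extG]; split=> // S T cS TS.
have [z [zS [zT zST]]] := extG S (S :\: T) cS (subsetDl _ _).
exists z; split=> //; split=> x xS.
  rewrite coadjE; first by apply: zST; rewrite !inE xS (subsetP TS).
  by apply: contraNneq zS => ->; apply: (subsetP TS).
rewrite coadjE ?negbK; first by apply: zT.
by apply: contraNneq zS => ->; case/setDP: xS.
Qed.

Implicit Types X : {set vertex G}.

Lemma cl_complement X : @cl complement X <-> ind X.
Proof.
split=> cX x y xX yX xy; last by rewrite coadjE //; apply: cX.
by have := cX x y xX yX xy; rewrite coadjE.
Qed.

Lemma ind_complement X : @ind complement X <-> cl X.
Proof.
split=> cX x y xX yX xy; last by rewrite coadjE ?negbK //; apply: cX.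
by have := cX x y xX yX xy; rewrite coadjE ?negbK.
Qed.

Lemma phiC_complement X : @phiC complement X <-> phiI X.
Proof.
split=> -[z [zX zP]]; exists z; split=> // x xX.
  have zx : z != x by apply: contraNneq zX => ->.
  by have := zP x xX; rewrite coadjE ?negbK.
have zx : z != x by apply: contraNneq zX => ->.
by rewrite coadjE ?negbK //; apply: zP.
Qed.

Lemma phiI_complement X : @phiI complement X <-> phiC X.
Proof.
split=> -[z [zX zP]]; exists z; split=> // x xX.
  have zx : z != x by apply: contraNneq zX => ->.
  by have := zP x xX; rewrite coadjE.
have zx : z != x by apply: contraNneq zX => ->.
by rewrite coadjE //; apply: zP.
Qed.

Lemma maxcl_complement X : @maxcl complement X <-> maxind X.
Proof.
have := cl_complement X; have := phiI_complement X.
by rewrite /maxcl /maxind /phiI /phiC; tauto.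
Qed.

Lemma maxind_complement X : @maxind complement X <-> maxcl X.
Proof.
have := ind_complement X; have := phiC_complement X.
by rewrite /maxcl /maxind /phiI /phiC; tauto.
Qed.

Lemma complement_phiC :
  [/\ phiC1 complement <-> phiI1 G, phiC2 complement <-> phiI2 G
    & phiC3 complement <-> phiI3 G].
Proof.
split; split=> F X; have := F X; have := cl_complement X;
  have := phiC_complement X; have := maxcl_complement X; tauto.
Qed.

Lemma complement_phiI :
  [/\ phiI1 complement <-> phiC1 G, phiI2 complement <-> phiC2 G
    & phiI3 complement <-> phiC3 G].
Proof.
split; split=> F X; have := F X; have := ind_complement X;
  have := phiI_complement X; have := maxind_complement X; tauto.
Qed.

Lemma sees_complement X (x : vertex G) a :
  @sees complement X x a = sees X x (~~ a).
Proof.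
apply/seesP/seesP => -[y [yX yx xy]]; exists y; split=> //.
  by rewrite -xy coadjE ?negbK // eq_sym.
by rewrite coadjE 1?eq_sym // xy negbK.
Qed.

End Complement.

Lemma similar_complement G H (X : {set vertex G}) (Y : {set vertex H}) :
  @similar (complement G) (complement H) X Y -> similar X Y.
Proof.
have E (x : vertex G) (y : vertex H) :
    @vtype (complement G) X x = @vtype (complement H) Y y -> vtype X x = vtype Y y.
  by rewrite /vtype !sees_complement => -[-> -> -> -> ->].
move=> [forth back]; split=> [x|y].
  by have [y e] := forth x; exists y; apply: E.
by have [x e] := back y; exists x; apply: E.
Qed.

(** * Classification of vertex subsets *)

Section Cliques.
Variable G : graph.
Implicit Types X : {set vertex G}.

Definition clb X := [forall x in X, forall y in X, (x != y) ==> adj x y].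
Definition joined X a :=
  [exists z, (z \notin X) && [forall x in X, adj z x == a]].

Lemma clP X : reflect (cl X) (clb X).
Proof.
apply: (iffP forall_inP) => [cX x y xX yX xy|cX x xX].
  by have /forall_inP/(_ y yX)/implyP := cX x xX; apply.
by apply/forall_inP => y yX; apply/implyP; apply: cX.
Qed.

Lemma phiIP X : reflect (phiI X) (joined X true).
Proof.
apply: (iffP existsP) => -[z]; first case/andP=> zX /forall_inP zP.
  by exists z; split=> // x /zP/eqP.
by case=> zX zP; exists z; rewrite zX; apply/forall_inP => x /zP->.
Qed.

Lemma phiCP X : reflect (phiC X) (joined X false).
Proof.
apply: (iffP existsP) => -[z]; first case/andP=> zX /forall_inP zP.
  by exists z; split=> // x /zP/eqP->.
by case=> zX zP; exists z; rewrite zX; apply/forall_inP => x /zP/negPf->.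
Qed.

Lemma maxclP X : reflect (maxcl X) (clb X && ~~ joined X true).
Proof.
by apply: (iffP andP) => -[/clP cX]; [move=> /phiIP | move=> nX; split=> //; apply/phiIP].
Qed.

Lemma maxcl_exists X : cl X -> exists2 M : {set vertex G}, X \subset M & maxcl M.
Proof.
move=> /clP cX; have [M /maxsetP[/clP cM maxM] XM] := maxset_exists cX.
exists M => //; split=> // -[z [zM zP]].
suff zMM : z |: M = M by rewrite -zMM setU11 in zM.
apply: maxM; last exact: subsetUr.
apply/clP => x y; rewrite !inE.
case/orP=> [/eqP->|xM]; case/orP=> [/eqP->|yM]; rewrite ?eqxx // => xy.
- exact: zP.
- by rewrite adj_sym; apply: zP.
- exact: cM.
Qed.

(** Here [a] records whether the clique can be extended and [b] whether it fails to be dominating.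
    Each of the three sentences forbids exactly one kind other than [true true]. *)
Definition clique_kind a b :=
  [exists X, [&& clb X, joined X true == a & joined X false == b]].

(** A dominating clique lies in a maximal one, which is still dominating and hence has kind
    [false false]. *)
Lemma phiC1_kind : phiC1 G <-> ~~ clique_kind false false.
Proof.
split=> [F|/existsPn F X cX].
  apply/existsP => -[X /and3P[/clP cX _ /eqP nX]].
  by have /phiCP := F X cX; rewrite nX.
apply/phiCP; have [//|nX] := boolP (joined X false).
have [M XM [cM nM]] := maxcl_exists cX.
case/negP: (F M); apply/and3P; split; [exact/clP|by rewrite eqbF_neg; apply/phiIP|].
rewrite eqbF_neg; apply: contra nX => /phiCP[z [zM zP]]; apply/phiCP.
exists z; split; first by apply: contra zM; apply: (subsetP XM).
by move=> x /(subsetP XM); apply: zP.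
Qed.

Lemma phiC2_kind : phiC2 G <-> ~~ clique_kind false true.
Proof.
split=> [F|/existsPn F X /maxclP/andP[cX nX] /phiCP pX].
  apply/existsP => -[X /and3P[cX /eqP/negbT nX /eqP/phiCP]].
  by apply: F; apply/maxclP; rewrite cX.
by case/negP: (F X); rewrite cX pX (negPf nX).
Qed.

Lemma phiC3_kind : phiC3 G <-> ~~ clique_kind true false.
Proof.
split=> [F|/existsPn F X [/clP cX nX]].
  apply/existsP => -[X /and3P[cX /eqP/phiIP pX /eqP/negbT/phiCP nX]].
  by have /F[_ ] : cl X /\ ~ phiC X by split=> //; apply/clP.
have {}nX : ~~ joined X false by apply/phiCP.
apply/maxclP; rewrite cX; apply: contra (F X) => pX.
by rewrite cX pX (negPf nX).
Qed.

End Cliques.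

Lemma another_mem (T : finType) (A : {set T}) :
  1 < #|A| -> forall x, exists2 y, y \in A & y != x.
Proof.
move=> A1 x; have /card_gt0P[y] : 0 < #|A :\ x|.
  by move: A1; rewrite (cardsD1 x); case: (x \in A) => //; apply: ltnW.
by rewrite !inE => /andP[]; exists y.
Qed.

(** * Consequences of the extension property *)

Section Extension.
Variable G : graph.
Implicit Types (x y z u v w : vertex G) (X Z : {set vertex G}) (a b : bool).

(** Smaller sets are padded to exactly [s] vertices, which the lower bound on the order of the graph
    makes possible; the padding stays outside [T]. *)
Lemma ext_le s (S T : {set vertex G}) :
  has_ext s G -> #|S| <= s -> T \subset S ->
  exists2 z, z \notin S & forall x, x \in S -> adj z x = (x \in T).
Proof.
move=> [sG extG] cS TS.
have [R SR cR] : exists2 R : {set vertex G}, S \subset R & #|R| = s.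
  elim: {extG} s sG cS => [|s IHs] sG.
    by rewrite leqn0 cards_eq0 => /eqP->; exists set0; rewrite ?cards0.
  rewrite leq_eqVlt => /orP[/eqP cS|]; first by exists S.
  rewrite ltnS => /(IHs (ltnW sG))[R SR cR].
  have /card_gt0P[z] : 0 < #|~: R| by rewrite cardsCs setCK cR subn_gt0.
  rewrite inE => zR; exists (z |: R); last by rewrite cardsU1 zR cR.
  exact: subset_trans (subsetUr _ _).
have [z [zR [zT zRT]]] := extG R T cR (subset_trans TS SR).
exists z => [|x xS]; first by apply: contra zR; apply: (subsetP SR).
have [/zT//|xT] := boolP (x \in T).
by apply/negbTE/zRT; rewrite inE xT (subsetP SR).
Qed.

Hypothesis extG : has_ext 4 G.

Lemma ext_seq (r : seq (vertex G)) (f : vertex G -> bool) : size r <= 4 ->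
  exists2 z, z \notin r & forall x, x \in r -> adj x z = f x.
Proof.
move=> sr; have cr := leq_trans (card_size r) sr.
have [||z zr zP] := @ext_le 4 [set x in r] [set x in r | f x] extG.
- by rewrite cardsE.
- by apply/subsetP => x; rewrite !inE => /andP[].
exists z => [|x xr]; first by rewrite inE in zr.
by rewrite adj_sym zP ?inE xr.
Qed.

Lemma ext0 : inhabited (vertex G).
Proof. by have [z] := @ext_seq [::] xpred0 isT; exists. Qed.

Lemma ext1 u a : exists2 z, z != u & adj u z = a.
Proof.
have [//|z] := @ext_seq [:: u] (fun=> a).
by rewrite inE => zu /(_ u (mem_head _ _)); exists z.
Qed.

Lemma ext2 u v a b : u != v ->
  exists z, [/\ z != u, z != v, adj u z = a & adj v z = b].
Proof.
move=> uv; have [//|z] := @ext_seq [:: u; v] (fun x => if x == u then a else b).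
rewrite !inE negb_or => /andP[zu zv] zP; exists z; split=> //.
  by rewrite zP ?inE eqxx.
by rewrite zP ?inE ?eqxx ?orbT // eq_sym (negPf uv).
Qed.

Lemma ext3 u v w a b c : uniq [:: u; v; w] ->
  exists z, [/\ z \notin [:: u; v; w], adj u z = a, adj v z = b & adj w z = c].
Proof.
rewrite /= !inE andbT negb_or => /andP[/andP[uv uw] vw].
have [//|z zr zP] := @ext_seq [:: u; v; w]
  (fun x => if x == u then a else if x == v then b else c).
exists z; split=> //; rewrite zP ?inE ?eqxx ?orbT //.
  by rewrite eq_sym (negPf uv).
by rewrite eq_sym (negPf uw) eq_sym (negPf vw).
Qed.

Lemma ext4 u v w x a b c d : uniq [:: u; v; w] -> x \notin [:: u; v; w] ->
  exists z, [/\ z \notin [:: u; v; w] & z != x] /\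
    [/\ adj u z = a, adj v z = b, adj w z = c & adj x z = d].
Proof.
rewrite /= !inE andbT !negb_or => /andP[/andP[uv uw] vw] /and3P[xu xv xw].
have [//|z + zP] := @ext_seq [:: u; v; w; x]
  (fun y => if y == u then a else if y == v then b else if y == w then c else d).
rewrite !inE !negb_or => /and4P[zu zv zw zx]; exists z; split.
  by rewrite zx !negb_or zu zv zw.
split; rewrite zP ?inE ?eqxx ?orbT //.
- by rewrite eq_sym (negPf uv).
- by rewrite eq_sym (negPf uw) eq_sym (negPf vw).
- by rewrite (negPf xu) (negPf xv) (negPf xw).
Qed.

Lemma sees_total X u a : sees X u a || sees (~: X) u a.
Proof.
have [z zu uz] := ext1 u a; rewrite -uz; have [zX|zX] := boolP (z \in X).
  by rewrite sees_adj.
by rewrite (@sees_adj _ (~: X)) ?inE ?orbT.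
Qed.

(** If [u] and [v] differed, some [z] would have adjacency [a] to [u] and [b] to [v]. It would lie
    in [X] or in its complement, against one of the hypotheses. *)
Lemma clean_unique X u v a b :
  ~~ sees X u a -> ~~ sees (~: X) v b -> u = v.
Proof.
move=> Xu Xv; apply/eqP/negPn/negP => uv.
have [z [zu zv uz vz]] := ext2 a b uv.
have [zX|zX] := boolP (z \in X); first by rewrite -uz sees_adj in Xu.
by rewrite -vz sees_adj ?inE in Xv.
Qed.

Definition sees_all Z := forall x a, sees Z x a.

(** If both [sees_all] statements fail, the two clean vertices coincide by [clean_unique]. By
    [sees_total] the adjacency missing in [X] is present in the complement, so the two missing
    values are opposite. *)
Lemma clean_dichotomy X :
  [\/ exists u a, ~~ sees X u a /\ ~~ sees (~: X) u (~~ a),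
      sees_all X | sees_all (~: X)].
Proof.
have [/existsP[u /existsP[a Xu]]|/existsPn XA] :=
  boolP [exists u, exists a, ~~ sees X u a]; last first.
  by apply: Or32 => x a; have /existsPn/(_ a) := XA x; rewrite negbK.
have [/existsP[v /existsP[b Xv]]|/existsPn XA] :=
  boolP [exists v, exists b, ~~ sees (~: X) v b]; last first.
  by apply: Or33 => x b; have /existsPn/(_ b) := XA x; rewrite negbK.
apply: Or31; exists u, a; split=> //.
have e := clean_unique Xu Xv; rewrite -e in Xv.
have := sees_total X u a; rewrite (negPf Xu) /= => Xa.
by case: a b Xa Xv {Xu} => [] [] // ->.
Qed.

(** All types are forced here: that of [u] by [a] and its side, and every other vertex sees
    everything by [clean_unique]. Both sides contain such other vertices. *)
Lemma clean_both X u a : ~~ sees X u a -> ~~ sees (~: X) u (~~ a) ->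
  [/\ forall b, sees X u b = (b != a) /\ sees (~: X) u b = (b == a),
      forall x, x != u -> forall b, sees X x b && sees (~: X) x b
    & forall c, exists2 x, x != u & (x \in X) = c].
Proof.
move=> Xu Yu; have XuN : sees X u (~~ a).
  by have := sees_total X u (~~ a); rewrite (negPf Yu) orbF.
have YuN : sees (~: X) u a by have := sees_total X u a; rewrite (negPf Xu).
split=> [b|x xu b|[]].
- move/negPf: Xu XuN; move/negPf: Yu YuN.
  by case: a b => [] [] /= e1 e2 e3 e4; split.
- have [/=|xb] := boolP (sees X x b); last first.
    by rewrite (clean_unique xb Yu) eqxx in xu.
  have [//|xb] := boolP (sees (~: X) x b).
  by rewrite (clean_unique Xu xb) eqxx in xu.
- by have /seesP[x [? ? _]] := XuN; exists x.
- by have /seesP[x []] := YuN; rewrite inE => /negPf ? ? _; exists x.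
Qed.

(** When [sees_all (~: X)] holds, the last two components of a type are constantly true, so three
    Booleans describe it. *)
Definition realized X b c d :=
  [exists x, [&& (x \in X) == b, sees X x true == c & sees X x false == d]].

Lemma realizedP X b c d :
  reflect (exists x, [/\ (x \in X) = b, sees X x true = c & sees X x false = d])
          (realized X b c d).
Proof.
apply: (iffP existsP) => -[x].
  by case/and3P=> /eqP ? /eqP ? /eqP ?; exists x.
by case=> <- <- <-; exists x; rewrite !eqxx.
Qed.

Lemma realized_set0 b c d : realized set0 b c d = [&& ~~ b, ~~ c & ~~ d].
Proof.
have no x a : sees set0 x a = false.
  by apply/seesP => -[y []]; rewrite inE.
have [x0] := ext0; apply/realizedP/idP => [[x []]|].
  by rewrite inE !no => <- <- <-.
by case: b c d => [] [] [] // _; exists x0; rewrite !no inE.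
Qed.

Lemma realized_set1 u b c d :
  realized [set u] b c d = if b then ~~ c && ~~ d else c (+) d.
Proof.
have un a : sees [set u] u a = false.
  by apply/seesP => -[y []]; rewrite inE => ->.
have ot x a : x != u -> sees [set u] x a = (adj x u == a).
  move=> xu; apply/seesP/eqP => [[y []]|<-]; first by rewrite inE => /eqP-> _ ->.
  by exists u; rewrite inE eqxx eq_sym.
apply/realizedP/idP => [[x []]|].
  rewrite inE; case: eqVneq => [->|xu]; first by rewrite !un => <- <- <-.
  by rewrite !ot // => <- <- <-; case: adj.
case: b => [/andP[/negPf-> /negPf->]|cd].
  by exists u; rewrite inE eqxx !un.
have [x xu ux] := ext1 u c; exists x; rewrite inE (negPf xu) !ot // adj_sym ux.
by case: c d cd {ux} => [] [].
Qed.

Lemma sees_all_setT : sees_all (~: set0).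
Proof. by move=> x a; have [z zx <-] := ext1 x a; rewrite sees_adj ?inE. Qed.

Lemma sees_all_setC1 u : sees_all (~: [set u]).
Proof.
move=> x a; have [->|xu] := eqVneq x u.
  by have [z zu <-] := ext1 u a; rewrite sees_adj ?inE.
have [z [zx zu <- _]] := ext2 a a xu.
by rewrite sees_adj ?inE.
Qed.

(** A vertex not adjacent to some other [y] in [X] cannot belong to the clique, and its adjacency to
    [x] can still be prescribed. *)
Lemma sees_all_clique X : 1 < #|X| -> cl X -> sees_all (~: X).
Proof.
move=> X1 cX x a.
have [y yX yx] := another_mem X1 x.
have [z [zy zx yz <-]] := ext2 false a yx.
rewrite sees_adj ?inE //; apply/negP => zX.
by have := cX y z yX zX; rewrite yz eq_sym zy => /(_ isT).
Qed.

Section Regular.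
Variable X : {set vertex G}.
Hypotheses (X1 : 1 < #|X|) (seesC : sees_all (~: X)).

Lemma sees_some x : sees X x true || sees X x false.
Proof.
have [y yX yx] := another_mem X1 x.
by have := sees_adj yX yx; case: adj => ->; rewrite ?orbT.
Qed.

Lemma realized_none b : realized X b false false = false.
Proof.
by apply/realizedP => -[x [_ xT xF]]; have := sees_some x; rewrite xT xF.
Qed.

(** Take an outside neighbour [y] of some [x] in [X]. If [y] is adjacent to all of [X], then a
    vertex adjacent to [x] but neither to [x'] nor to [y] is outside [X] and sees both values. *)
Lemma realized_outer : realized X false true true.
Proof.
have /card_gt0P[x xX] := ltnW X1; have [x' x'X x'x] := another_mem X1 x.
have /seesP[y [yX yx xy]] := seesC x true.
have memR z : z \notin X -> sees X z true -> sees X z false ->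
    realized X false true true.
  by move=> /negPf zX zT zF; apply/realizedP; exists z.
rewrite inE in yX.
have yT : sees X y true by rewrite -xy adj_sym sees_adj // eq_sym.
have [yF|yF] := boolP (sees X y false); first exact: (memR y).
have x'y : x' != y by apply: contraNneq yX => <-.
have [|z [zr xz x'z yz]] := @ext3 x x' y true false false.
  by rewrite /= !inE negb_or andbT x'y ![x == _]eq_sym x'x yx.
move: zr; rewrite !inE !negb_or => /and3P[zx zx' zy].
apply: (memR z).
- by apply: contra yF => zX; rewrite -yz sees_adj.
- by rewrite -xz adj_sym sees_adj // eq_sym.
- by rewrite -x'z adj_sym sees_adj // eq_sym.
Qed.

Lemma realized_not_both :
  realized X true true false -> realized X true false true -> False.
Proof.
move=> /realizedP[x [xX xT xF]] /realizedP[y [yX yT yF]].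
have xy : y != x by apply: contraFneq xF => <-.
have := sees_adj yX xy; rewrite eq_sym in xy.
have := sees_adj xX xy; rewrite (adj_sym x).
by case: adj; rewrite ?yT ?xF.
Qed.

Lemma joined_realized a : joined X a = realized X false a (~~ a).
Proof.
apply/existsP/realizedP => -[z].
  case/andP=> zX /forall_inP zP; exists z; rewrite (negPf zX).
  have zA : sees X z a.
    have [y yX yz] := another_mem X1 z.
    by rewrite -(eqP (zP y yX)) sees_adj.
  have zN : sees X z (~~ a) = false.
    apply/seesP => -[y [yX _ zy]]; have := zP y yX.
    by rewrite zy; case: (a).
  by case: (a) zA zN => -> ->.
case=> zX zT zF; exists z; rewrite zX; apply/forall_inP => x xX.
have xz : x != z by apply: contraFneq zX => <-.
by have := sees_adj xX xz; case: adj a zT zF => [] [] //= zT zF; rewrite ?zT ?zF.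
Qed.

Lemma clique_realized : cl X <->
  ~~ realized X true true true && ~~ realized X true false true.
Proof.
split=> [cX|].
  have no x : x \in X -> sees X x false = false.
    move=> xX; apply/seesP => -[y [yX yx xy]].
    by have := cX x y xX yX; rewrite eq_sym yx xy => /(_ isT).
  by apply/andP; split; apply/realizedP => -[x [xX _]]; rewrite no.
move=> /andP[nTT nFT] x y xX yX xy; apply/negPn/negP => nxy.
have xF : sees X x false by rewrite -(negPf nxy) sees_adj // eq_sym.
case xT: (sees X x true).
  by case/negP: nTT; apply/realizedP; exists x.
by case/negP: nFT; apply/realizedP; exists x.
Qed.

(** If no inner vertex is mixed and [X] is not a clique, some inner vertex has only non-neighbours
    in [X]. An edge in [X] would then give an inner vertex with only neighbours, against
    [realized_not_both]. *)
Lemma mixed_clique_or_ind : [\/ realized X true true true, cl X | ind X].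
Proof.
have [TT|nTT] := boolP (realized X true true true); first exact: Or31.
have [FT|nFT] := boolP (realized X true false true); last first.
  by apply/Or32/clique_realized; rewrite nTT.
apply: Or33 => x y xX yX xy; apply/negP => xy1.
have xT : sees X x true by rewrite -xy1 sees_adj // eq_sym.
case xF: (sees X x false).
  by case/negP: nTT; apply/realizedP; exists x.
by apply: realized_not_both FT; apply/realizedP; exists x.
Qed.

End Regular.

(** Sets with a mixed inner vertex cannot tell graphs apart: every combination of clean types
    allowed by [realized_not_both] is built here. [pA] and [pN] ask for an inner vertex adjacent to
    all, resp. none, of the others; [qA] and [qN] ask the same of outer vertices. *)
Lemma generic_set (pA pN qA qN : bool) : ~~ (pA && pN) ->
  exists X : {set vertex G}, [/\ 1 < #|X|, sees_all (~: X),
    [/\ realized X true true false = pA, realized X true false true = pN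
      & realized X true true true],
    realized X false true false = qA & realized X false false true = qN].
Proof.
move=> pAN; have [v] := ext0.
(* All of [R] below will be adjacent to [w] and none of it to [w']. So the adjacency of [w] and [w']
   to [v] alone decides whether they are clean for [X]; that between [w] and [w'] is arbitrary. *)
have [w wv vw] := ext1 v qA; rewrite eq_sym in wv.
have [w' [w'v w'w vw' _]] := ext2 (~~ qN) true wv.
have U : uniq [:: v; w; w'].
  by rewrite /= !inE negb_or andbT wv eq_sym w'v eq_sym.
pose R := [set x | [&& x \notin [:: v; w; w'], adj w x, ~~ adj w' x,
  pA ==> adj v x & pN ==> ~~ adj v x]].
(* Only [v] can be clean for X inside X, and only [w] and [w'] outside X. *)
pose X := v |: R.
have vX : v \in X by rewrite setU11.
have wX : w \notin X by rewrite !inE eq_sym (negPf wv) eqxx !orbT.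
have w'X : w' \notin X by rewrite !inE (negPf w'v) eqxx !orbT.
have RX z : z \in R -> z \in X by rewrite in_setU1 orbC => ->.
have RI z a : z \notin [:: v; w; w'] -> adj w z = true -> adj w' z = false ->
    adj v z = a -> pA ==> a -> pN ==> ~~ a -> z \in R.
  by move=> zr wz w'z vz Aa Na; rewrite inE zr wz w'z vz Aa Na.
have RE x a : x \notin [:: v; w; w'] -> sees R x a.
  (* Adjacency [pA] to [v] meets both implications in [R], as [pA] and [pN] are not both true. *)
  move=> xr; have [z [[zr zx] [vz wz w'z <-]]] := @ext4 v w w' x pA true false a U xr.
  rewrite sees_adj //; apply: RI vz _ _ => //; first exact: implybb.
  by case: (pA) (pN) pAN => [] [].
have R0 a : pA ==> a -> pN ==> ~~ a -> exists2 z, z \in R & adj v z = a.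
  move=> Aa Na; have [z [zr vz wz w'z]] := @ext3 v w w' a true false U.
  by exists z => //; apply: RI vz _ _.
have [z0 z0R vz0] : exists2 z, z \in R & adj v z = pA.
  by apply: R0; rewrite ?implybb //; case: (pA) (pN) pAN => [] [].
have subR x a : sees R x a -> sees X x a.
  by case/seesP=> y [/RX yX yx <-]; rewrite sees_adj.
have Rv z : z \in R -> [/\ z != v, z != w & z != w'].
  by rewrite inE => /andP[+ _]; rewrite !inE !negb_or => /and3P[].
have vsees a : sees X v a = (pA ==> a) && (pN ==> ~~ a).
  apply/seesP/andP => [[y []]|[Aa Na]]; last first.
    have [z zR vz] := R0 a Aa Na; exists z; rewrite RX //.
    by have [] := Rv z zR.
  rewrite in_setU1 => /orP[->//|+ _ <-].
  by rewrite inE => /and5P[].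
have Xout x a : x \notin [:: v; w; w'] -> sees X x a by move=> /RE/subR.
have XR x : x \in X -> x = v \/ x \notin [:: v; w; w'].
  by rewrite in_setU1 => /orP[/eqP|]; [left | rewrite inE => /andP[]; right].
have wsees a : sees X w a = a || ~~ qA.
  apply/seesP/idP => [[y []]|].
    rewrite in_setU1 => /orP[/eqP-> _|]; first by rewrite adj_sym vw => <-; case: (qA).
    by rewrite inE => /and5P[_ -> _ _ _] _ <-.
  case: a => /= [_|nA].
    by exists z0; have [_ z0w _] := Rv z0 z0R; move: z0R (RX _ z0R); rewrite inE => /and5P[].
  by exists v; rewrite wv adj_sym vw (negPf nA).
have w'sees a : sees X w' a = ~~ a || ~~ qN.
  apply/seesP/idP => [[y []]|].
    rewrite in_setU1 => /orP[/eqP-> _|]; first by rewrite adj_sym vw' => <-; case: (qN).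
    by rewrite inE => /and5P[_ _ /negPf-> _ _] _ <-.
  case: a => /= [nN|_].
    by exists v; rewrite eq_sym w'v adj_sym vw' nN.
  exists z0; have [_ _ z0w] := Rv z0 z0R; move: z0R (RX _ z0R).
  by rewrite inE => /and5P[_ _ /negPf].
exists X; split.
- rewrite cardsU1; have [z0v _ _] := Rv _ z0R.
  have -> : v \notin R by rewrite inE mem_head.
  by rewrite ltnS card_gt0; apply/set0Pn; exists z0.
- move=> x a.
  have out z : z \notin [:: v; w; w'] -> adj w z = false \/ adj w' z = true ->
      z \in ~: X.
    rewrite in_setC in_setU1 negb_or => zr E; apply/andP; split.
      by move: zr; rewrite inE negb_or => /andP[].
    by rewrite inE zr; case: E => ->; rewrite ?andbF.
  have [xr|xr] := boolP (x \in [:: v; w; w']); last first.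
    have [z [[zr zx] [_ wz _ <-]]] := @ext4 v w w' x true false true a U xr.
    by rewrite sees_adj //; apply: out; [|left].
  (* One pattern serves the three values of [x]: adjacency to [x] is [a], and [z] is kept out of [X]
     by being adjacent to [w'] if [a] is true and non-adjacent to [w] otherwise. *)
  have [z [zr vz wz w'z]] := @ext3 v w w' a (a && (x == w)) (a || (x != w')) U.
  have zC : z \in ~: X.
    apply: out => //; rewrite wz w'z; case: (a); last by left.
    by right.
  have zx : z != x by apply: contraNneq zr => ->.
  suff <- : adj x z = a by rewrite sees_adj.
  move: xr; rewrite !inE => /or3P[]/eqP E; subst x; rewrite ?vz ?wz ?w'z ?eqxx.
  + by [].
  + by rewrite andbT.
  + by rewrite orbF.
- have inner c d : realized X true c d =
    ((c == ~~ pN) && (d == ~~ pA)) || (c && d).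
    apply/realizedP/idP => [[x [/XR[->|xr]]]|].
    + rewrite !vsees => <- <-; by case: (pA) (pN) pAN => [] [].
    + by rewrite !Xout // => <- <-; rewrite orbT.
    + case/orP=> [/andP[/eqP-> /eqP->]|/andP[-> ->]].
        by exists v; rewrite vX !vsees; case: (pA) (pN) pAN => [] [].
      exists z0; rewrite RX // !Xout //; by move: z0R; rewrite inE => /andP[].
  by rewrite !inner; case: (pA) (pN) pAN => [] [].
- apply/realizedP/idP => [[x [/negbT xX xT xF]]|A].
    have [xr|/Xout E] := boolP (x \in [:: v; w; w']); last by rewrite E in xF.
    move: xr xX xT xF; rewrite !inE => /or3P[]/eqP->; rewrite ?eqxx //.
      by move=> _; rewrite !wsees /= => _ /negbFE.
    by rewrite !w'sees.
  by exists w; rewrite (negPf wX) !wsees A.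
- apply/realizedP/idP => [[x [/negbT xX xT xF]]|A].
    have [xr|/Xout E] := boolP (x \in [:: v; w; w']); last by rewrite E in xT.
    move: xr xX xT xF; rewrite !inE => /or3P[]/eqP->; rewrite ?eqxx //.
      by rewrite !wsees.
    by move=> _; rewrite !w'sees /= => /negbFE.
  by exists w'; rewrite (negPf w'X) !w'sees A.
Qed.

Lemma joined_small X a : #|X| <= 1 -> joined X a.
Proof.
rewrite leq_eqVlt ltnS leqn0 cards_eq0 => /orP[/cards1P[u ->]|/eqP->].
  have [z zu uz] := ext1 u a; apply/existsP; exists z.
  rewrite inE zu; apply/forall_inP => x; rewrite inE => /eqP->.
  by rewrite adj_sym uz.
have [z] := ext0; apply/existsP; exists z; rewrite inE.
by apply/forall_inP => x; rewrite inE.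
Qed.

End Extension.

(** * Matching a set in one graph by a set in another *)

Lemma similar_realized G H (X : {set vertex G}) (Y : {set vertex H}) :
    sees_all (~: X) -> sees_all (~: Y) ->
    (forall b c d, realized X b c d = realized Y b c d) ->
  similar X Y.
Proof.
move=> XC YC eXY; split=> [x|y].
  have : realized X (x \in X) (sees X x true) (sees X x false).
    by apply/realizedP; exists x.
  rewrite eXY => /realizedP[y [e1 e2 e3]]; exists y.
  by rewrite /vtype e1 e2 e3 !XC !YC.
have : realized Y (y \in Y) (sees Y y true) (sees Y y false).
  by apply/realizedP; exists y.
rewrite -eXY => /realizedP[x [e1 e2 e3]]; exists x.
by rewrite /vtype e1 e2 e3 !XC !YC.
Qed.

Section CliqueTransfer.
Variables G H : graph.
Hypotheses (extG : has_ext 4 G) (extH : has_ext 4 H).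

Lemma similar_regular (X : {set vertex G}) (Y : {set vertex H}) :
    1 < #|X| -> 1 < #|Y| -> sees_all (~: X) -> sees_all (~: Y) ->
    (forall b c d, ~~ [&& ~~ b, c & d] -> c || d ->
      realized X b c d = realized Y b c d) ->
  similar X Y.
Proof.
move=> X1 Y1 XC YC eXY; apply: similar_realized => // b c d.
case: (boolP (c || d)) => [cd|]; last first.
  by rewrite negb_or => /andP[/negPf-> /negPf->]; rewrite !realized_none.
case: (boolP [&& ~~ b, c & d]) => [/and3P[/negPf-> -> ->]|n]; last exact: eXY.
by rewrite !realized_outer.
Qed.

(** The types of a clique with two vertices or more depend only on its kind: inner vertices see only
    neighbours, mixed outer vertices always occur, and clean outer ones are what [joined] records.
    An edge has kind [true true]; the sentences transfer the other kinds. *)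
Lemma similar_clique (X : {set vertex G}) :
    (phiC1 G <-> phiC1 H) -> (phiC2 G <-> phiC2 H) -> (phiC3 G <-> phiC3 H) ->
    1 < #|X| -> cl X ->
  exists Y : {set vertex H}, similar X Y.
Proof.
move=> e1 e2 e3 X1 cX.
have kindHG : [/\ clique_kind G false false -> clique_kind H false false,
    clique_kind G false true -> clique_kind H false true
  & clique_kind G true false -> clique_kind H true false].
  split; apply: contraLR.
  - by move=> /phiC1_kind/e1/phiC1_kind.
  - by move=> /phiC2_kind/e2/phiC2_kind.
  - by move=> /phiC3_kind/e3/phiC3_kind.
have kindX : clique_kind G (joined X true) (joined X false).
  by apply/existsP; exists X; rewrite !eqxx !andbT; apply/clP.
have [Y [Y1 cY jT jF]] : exists Y : {set vertex H},
    [/\ 1 < #|Y|, cl Y, joined X true = joined Y true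
      & joined X false = joined Y false].
  case: (boolP (joined X true && joined X false)) => [/andP[-> ->]|nb].
    have [v] := ext0 extH; have [w wv vw] := ext1 extH v true.
    exists [set v; w]; split; first by rewrite cards2 eq_sym wv.
    + move=> x y; rewrite !inE => /orP[]/eqP-> /orP[]/eqP->;
        by rewrite ?eqxx // adj_sym.
    + have [|z [zv zw vz wz]] := @ext2 _ extH v w true true; first by rewrite eq_sym.
      symmetry; apply/existsP; exists z; rewrite !inE negb_or zv zw.
      by apply/forall_inP => x; rewrite !inE adj_sym => /orP[]/eqP->; rewrite ?vz ?wz.
    + have [|z [zv zw vz wz]] := @ext2 _ extH v w false false; first by rewrite eq_sym.
      symmetry; apply/existsP; exists z; rewrite !inE negb_or zv zw.
      by apply/forall_inP => x; rewrite !inE adj_sym => /orP[]/eqP->; rewrite ?vz ?wz.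
  have : clique_kind H (joined X true) (joined X false).
    have [k00 k01 k10] := kindHG.
    by case: (joined X true) (joined X false) nb kindX => [] [] //.
  case/existsP=> Y /and3P[/clP cY /eqP jT /eqP jF]; exists Y; split=> //.
  (* A set with at most one vertex has kind [true true], which [nb] excludes. *)
  rewrite ltnNge; apply/negP => Y1.
  by rewrite -jT -jF !(joined_small extH) in nb.
exists Y; have XC := sees_all_clique extG X1 cX; have YC := sees_all_clique extH Y1 cY.
have /andP[nX1 nX2] := (clique_realized X).1 cX.
have /andP[nY1 nY2] := (clique_realized Y).1 cY.
apply: similar_regular => // -[] [] [] //= _ _.
- by rewrite (negPf nX1) (negPf nY1).
- have rI K (Z : {set vertex K}) : 1 < #|Z| -> ~~ realized Z true true true ->
    ~~ realized Z true false true -> realized Z true true false.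
    move=> Z1 n1 n2; have /card_gt0P[x xZ] := ltnW Z1.
    have : realized Z true (sees Z x true) (sees Z x false).
      by apply/realizedP; exists x.
    case: (sees Z x true) (sees Z x false) => [] []; rewrite ?(negPf n1) ?(negPf n2) //.
    by rewrite realized_none.
  by rewrite !rI.
- by rewrite (negPf nX2) (negPf nY2).
- by rewrite -!(joined_realized _ true).
- by rewrite -!(joined_realized _ false).
Qed.
End CliqueTransfer.

Section Transfer.
Variables G H : graph.
Hypotheses (extG : has_ext 4 G) (extH : has_ext 4 H).
Hypotheses (eC1 : phiC1 G <-> phiC1 H) (eC2 : phiC2 G <-> phiC2 H)
  (eC3 : phiC3 G <-> phiC3 H) (eI1 : phiI1 G <-> phiI1 H)
  (eI2 : phiI2 G <-> phiI2 H) (eI3 : phiI3 G <-> phiI3 H).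

Lemma similar_sees_all (X : {set vertex G}) :
  sees_all (~: X) -> exists Y : {set vertex H}, similar X Y.
Proof.
move=> XC; case: (ltnP 1 #|X|) => [X1|]; last first.
  rewrite leq_eqVlt ltnS leqn0 cards_eq0 => /orP[/cards1P[u ->]|/eqP->].
    have [v] := ext0 extH; exists [set v].
    apply: similar_realized; [exact: sees_all_setC1|exact: sees_all_setC1|].
    by move=> b c d; rewrite !realized_set1.
  exists set0; apply: similar_realized; [exact: sees_all_setT|exact: sees_all_setT|].
  by move=> b c d; rewrite !realized_set0.
have [TT|cX|iX] := mixed_clique_or_ind X.
- have nb : ~~ (realized X true true false && realized X true false true).
    by apply/negP => /andP[/realized_not_both].
  have [Y [Y1 YC [e1 e2 e3] e4 e5]] := generic_set extH
    (realized X false true false) (realized X false false true) nb.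
  exists Y; apply: similar_regular => // -[] [] [] //= _ _.
  by rewrite TT e3.
- exact: similar_clique.
have [c1 c2 c3] := complement_phiC G; have [d1 d2 d3] := complement_phiC H.
have [|||||Y sXY] := @similar_clique (complement G) (complement H)
  (complement_ext extG) (complement_ext extH) X.
- by move: c1 d1; tauto.
- by move: c2 d2; tauto.
- by move: c3 d3; tauto.
- by [].
- exact/cl_complement.
by exists Y; apply: similar_complement.
Qed.

Lemma similar_exists (X : {set vertex G}) : exists Y : {set vertex H}, similar X Y.
Proof.
case: (clean_dichotomy extG X) => [[u [a [Xu Yu]]]|XA|/similar_sees_all//]; last first.
  have [|Y sXY] := @similar_sees_all (~: X); first by rewrite setCK.
  by exists (~: Y); apply: similar_setC; rewrite setCK.
have [v] := ext0 extH.
(* Apart from [u], the set [X] consists of the [x] with [adj u x != a]; [Y] copies this around an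
   arbitrary [v]. *)
pose Y := [set y | if y == v then u \in X else adj v y != a].
have Yv : ~~ sees Y v a.
  by apply/seesP => -[y [+ /negPf yv vy]]; rewrite inE yv vy eqxx.
have Cv : ~~ sees (~: Y) v (~~ a).
  by apply/seesP => -[y [+ /negPf yv vy]]; rewrite !inE yv vy; case: (a).
have vY : (v \in Y) = (u \in X) by rewrite inE eqxx.
have [uX oX nX] := clean_both extG Xu Yu; have [uY oY nY] := clean_both extH Yv Cv.
have uv : vtype X u = vtype Y v.
  by rewrite /vtype vY !(uX _).1 !(uX _).2 !(uY _).1 !(uY _).2.
have ot x y : x != u -> y != v -> (x \in X) = (y \in Y) -> vtype X x = vtype Y y.
  move=> xu yv e; rewrite /vtype e.
  have /andP[-> ->] := oX x xu true; have /andP[-> ->] := oX x xu false.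
  by have /andP[-> ->] := oY y yv true; have /andP[-> ->] := oY y yv false.
exists Y; split=> [x|y].
  have [->|xu] := eqVneq x u; first by exists v.
  by have [y yv yY] := nY (x \in X); exists y; apply: ot.
have [->|yv] := eqVneq y v; first by exists u.
by have [x xu xX] := nX (y \in Y); exists x; apply: ot.
Qed.
End Transfer.

Lemma E12_transfer (G H : graph) : has_ext 4 G -> has_ext 4 H ->
    (phiC1 G <-> phiC1 H) -> (phiC2 G <-> phiC2 H) -> (phiC3 G <-> phiC3 H) ->
    (phiI1 G <-> phiI1 H) -> (phiI2 G <-> phiI2 H) -> (phiI3 G <-> phiI3 H) ->
  forall phi, E12 phi -> sat_E12 G phi -> sat_E12 H phi.
Proof.
move=> extG extH eC1 eC2 eC3 eI1 eI2 eI3 phi phiE [X satX].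
have [Y sXY] := similar_exists extG extH eC1 eC2 eC3 eI1 eI2 eI3 X.
by exists Y; apply: (similar_sat phiE sXY).1.
Qed.

(** * Random coloured graphs *)

Lemma linear_lt_exp2 B : exists l, (B + l) * B < 2 ^ l.
Proof.
exists (4 * B); have lt2 : B < 2 ^ B by apply: ltn_expl.
have le4 : 4 * B <= 2 ^ B * 2 ^ B.
  by apply: leq_trans (leq_mul lt2 lt2); case: (B) => // b; nia.
have -> : 2 ^ (4 * B) = (2 ^ B * 2 ^ B) * (2 ^ B * 2 ^ B).
  by rewrite -!expnD; congr (_ ^ _); lia.
by move: (2 ^ B * 2 ^ B) le4 (leq_mul lt2 lt2) => r; nia.
Qed.

Lemma leq_expl m n k : m <= n -> m ^ k <= n ^ k.
Proof. by case: k => // k; rewrite leq_exp2r. Qed.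

Lemma poly_lt_exp2 A k : exists2 M, 0 < M & (A * M) ^ k < 2 ^ M.
Proof.
have [l ltl] := linear_lt_exp2 (A + k).
(* For a power of two the claim becomes one on exponents, [(A + l) * k < 2 ^ l], by [A < 2 ^ A]. *)
exists (2 ^ l); first by rewrite expn_gt0.
apply: (@leq_ltn_trans (2 ^ ((A + l) * k))); last first.
  by rewrite ltn_exp2l //; nia.
by rewrite expnM leq_expl // expnD leq_mul // ltnW // ltn_expl.
Qed.

(** The first two terms of the binomial expansion, bounded in [bern], already suffice. *)
Lemma double_expn p : 2 * p ^ p.+1 <= p.+1 ^ p.+1.
Proof.
have bern k : p ^ k.+1 + k.+1 * p ^ k <= p.+1 ^ k.+1.
  elim: k => [|k IHk]; first by rewrite !expn1 expn0; lia.
  rewrite (expnS p.+1) [in leqLHS]expnS; move: IHk; rewrite !expnS; nia.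
by apply: leq_trans (bern p); rewrite expnS; nia.
Qed.

(** This is the numerical part of the union bound below. By [double_expn], [q] factors of [q.-1 / q]
    at least halve the product, so [w = q * M] gains [2 ^ M] against a polynomial in [M]. *)
Lemma exp_decay_beats_poly q c c' t : 0 < q ->
  exists2 w, 0 < w & (c * (t + w)) ^ t * c' * q.-1 ^ w < q ^ w.
Proof.
case: q => // p _ /=.
have [M M0 ltM] := poly_lt_exp2 (c * (t + p.+1) + c') t.+1.
exists (p.+1 * M); first by rewrite muln_gt0.
have leP : (c * (t + p.+1 * M)) ^ t * c' < 2 ^ M.
  apply: leq_ltn_trans ltM; rewrite expnSr leq_mul ?leq_expl //; nia.
have leE : 2 ^ M * p ^ (p.+1 * M) <= p.+1 ^ (p.+1 * M).
  by rewrite !expnM -expnMn leq_expl // double_expn.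
case: (posnP (p ^ (p.+1 * M))) => [->|pos]; first by rewrite muln0 expn_gt0.
by apply: leq_trans leE; rewrite ltn_pmul2r.
Qed.

Lemma card_setC (T : finType) (A : {set T}) : #|~: A| = #|T| - #|A|.
Proof. by rewrite cardsCs setCK. Qed.

(** * Counting the samples that miss an adjacency pattern *)

Section Counting.
Variable V : finType.
Implicit Types (S W : {set V}) (f : V -> bool).

Local Notation weights := {ffun V -> {ffun V -> bool}}.

(** Symmetrizing by exclusive or keeps the sample space a full product: with [g y x] fixed, the edge
    is still a uniform bit in [g x y]. *)
Definition edge (g : weights) x y := g x y (+) g y x.

Lemma edge_sym g : symmetric (edge g).
Proof. by move=> x y; rewrite /edge addbC. Qed.

Definition pattern S f := [set h : {ffun V -> bool} | [forall x in S, h x == f x]].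

Lemma card_pattern S f : #|pattern S f| = 2 ^ (#|V| - #|S|).
Proof.
pose F x := if x \in S then pred1 (f x) else predT.
have -> : #|pattern S f| = #|family F|.
  apply: eq_card => h; rewrite inE; apply/forall_inP/familyP => hP x.
    by rewrite /F; case: ifP => // /hP; rewrite inE.
  by move=> xS; have := hP x; rewrite /F xS inE.
rewrite card_family foldrE big_map big_enum /= (bigID (mem S)) /=.
rewrite big1 => [|x xS]; last by rewrite /F xS card1.
rewrite mul1n (eq_bigr (fun=> 2)) => [|x /negPf xS]; last first.
  by rewrite /F xS -card_bool; apply: eq_card.
rewrite prod_nat_const -card_setC.
by congr (_ ^ _); apply: eq_card => x; rewrite !inE.
Qed.

Definition missed S W f :=
  [set g : weights | [forall z in W, ~~ [forall x in S, edge g z x == f x]]].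

Definition shift S (g : weights) : weights :=
  [ffun z => [ffun x => g z x (+) ((z \notin S) && (x \in S) && g x z)]].

(** Only rows outside [S] change, and what is added to them is read from rows in [S], which stay
    fixed. *)
Lemma shiftK S : involutive (shift S).
Proof.
move=> g; apply/ffunP => z; apply/ffunP => x; rewrite !ffunE.
by case zS: (z \in S); case xS: (x \in S); rewrite ?ffunE /= ?addbF //= -addbA addbb addbF.
Qed.

(* Conditionally on the values [g x], [x \in S], the rows [g z] shifted by
   [shift S] are independent and uniform. *)
Lemma card_missed S W f : [disjoint W & S] ->
  #|missed S W f| <=
    (2 ^ #|V| - 2 ^ (#|V| - #|S|)) ^ #|W| * (2 ^ #|V|) ^ (#|V| - #|W|).
Proof.
move=> WS; pose F z := if z \in W then [pred h | h \notin pattern S f] else predT.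
rewrite -(card_imset _ (inv_inj (shiftK S))).
have /subset_leq_card : shift S @: missed S W f \subset family F.
  apply/subsetP => _ /imsetP[g + ->]; rewrite inE => /forall_inP gP.
  apply/familyP => z; rewrite /F; case: ifP => // zW; rewrite !inE.
  have zS : z \notin S by rewrite (disjointFr WS zW).
  apply: contra (gP z zW) => /forall_inP hP; apply/forall_inP => x xS.
  by have := hP x xS; rewrite !ffunE zS xS.
move/leq_trans; apply.
rewrite card_family foldrE big_map big_enum /= (bigID (mem W)) /=.
have cV : #|{ffun V -> bool}| = 2 ^ #|V| by rewrite card_ffun card_bool.
rewrite (eq_bigr (fun=> 2 ^ #|V| - 2 ^ (#|V| - #|S|))) => [|z zW]; last first.
  rewrite /F zW -(card_pattern S f) -cV -card_setC.
  by apply: eq_card => h; rewrite !inE.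
rewrite prod_nat_const (eq_bigr (fun=> 2 ^ #|V|)) => [|z /negPf zW]; last first.
  by rewrite /F zW -cV; apply: eq_card.
rewrite prod_nat_const -(card_setC W) leq_mul // leq_pexp2l ?expn_gt0 //.
by apply: subset_leq_card; apply/subsetP => z; rewrite !inE.
Qed.

(** With denominators cleared, this bounds the probability of a miss by the power [#|W|] of
    [1 - 1 / 2 ^ t]. *)
Lemma card_missed_scaled t S W f : #|S| <= t -> t <= #|V| -> [disjoint W & S] ->
  #|missed S W f| * (2 ^ t) ^ #|W| <= (2 ^ t).-1 ^ #|W| * #|{: weights}|.
Proof.
move=> cS tV WS; rewrite !card_ffun card_bool.
apply: leq_trans (leq_mul (card_missed f WS) (leqnn _)) _.
rewrite mulnAC -expnMn.
have -> : (2 ^ #|V|) ^ #|V| = (2 ^ #|V|) ^ #|W| * (2 ^ #|V|) ^ (#|V| - #|W|).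
  by rewrite -expnD subnKC // max_card.
rewrite mulnA -expnMn leq_mul // leq_expl // -subn1 !mulnBl mul1n.
rewrite -!expnD [t + _]addnC leq_sub2l // leq_exp2l //; lia.
Qed.
End Counting.

Lemma subset_of_card (V : finType) (A : {set V}) k : k <= #|A| ->
  exists2 B : {set V}, B \subset A & #|B| = k.
Proof.
move=> kA; exists [set x in take k (enum A)].
  by apply/subsetP => x; rewrite inE => /mem_take; rewrite mem_enum.
rewrite cardsE (card_uniqP _) ?take_uniq ?enum_uniq //.
by rewrite size_takel // -cardE.
Qed.

Lemma card_bigcup_le (I T : finType) (F : I -> {set T}) :
  #|\bigcup_i F i| <= \sum_i #|F i|.
Proof.
elim/big_rec2: _ => [|i n A _ leA]; first by rewrite cards0.
by apply: leq_trans (leq_card_setU _ _) _; rewrite leq_add2l.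
Qed.

Definition generic (C V : finType) (col : V -> C) (e : rel V) t :=
  forall (i : C) (S : {set V}) (f : V -> bool), #|S| <= t ->
    exists z, [/\ z \notin S, col z = i & forall x, x \in S -> e z x = f x].

(** Union bound: polynomially many triples of a set, a pattern and a colour, each missed with
    exponentially small probability in the size of the colour classes. *)
Lemma generic_exists (C : finType) t :
  exists (V : finType) (col : V -> C) (e : rel V), symmetric e /\ generic col e t.
Proof.
have [w w0 ltw] := exp_decay_beats_poly #|C| (2 ^ t * #|C|) t (expn_gt0 2 t).
(* Each colour class keeps at least [w] vertices after the removal of [t]. *)
pose N := t + w; pose V : finType := (C * 'I_N)%type.
have cV : #|V| = #|C| * N by rewrite card_prod card_ord.
pose sample : finType := ({ffun 'I_t -> V} * {ffun 'I_t -> bool} * C)%type.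
pose S (p : sample) := [set p.1.1 j | j : 'I_t].
pose f (p : sample) x := [exists j, (p.1.1 j == x) && p.1.2 j].
pose Z (p : sample) := [set z : V | z.1 == p.2] :\: S p.
have [i0 _|C0] := pickP (mem C); last first.
  by exists V, fst, (fun _ _ => true); split=> // i; have := C0 i.
have tV : t <= #|V|.
  by rewrite cV /N; have : 0 < #|C| by [apply/card_gt0P; exists i0]; nia.
have cS p : #|S p| <= t by rewrite (leq_trans (leq_imset_card _ _)) // card_ord.
have cZ p : w <= #|Z p|.
  have cN : #|[set z : V | z.1 == p.2]| = N.
    have inj : injective (fun j : 'I_N => (p.2, j) : V) by move=> j k [].
    rewrite -[RHS]card_ord -cardsT -(card_imset _ inj).
    apply: eq_card => z; rewrite inE; apply/eqP/imsetP => [e|[j _ ->//]].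
    by exists z.2; rewrite // -e; case: (z).
  have := cardsID (S p) [set z : V | z.1 == p.2]; rewrite cN.
  have := subset_leq_card (subsetIr [set z : V | z.1 == p.2] (S p)).
  by have := cS p; rewrite /Z /N; lia.
have miss p : #|missed (S p) (Z p) (f p)| * (2 ^ t) ^ w <=
    (2 ^ t).-1 ^ w * #|{: {ffun V -> {ffun V -> bool}}}|.
  have [B BZ cB] := subset_of_card (cZ p).
  have BS : [disjoint B & S p].
    rewrite disjoints_subset; apply: subset_trans BZ _.
    by apply/subsetP => z; rewrite !inE => /andP[].
  rewrite -cB; apply: leq_trans (card_missed_scaled (f p) (cS p) tV BS).
  rewrite leq_mul2r subset_leq_card ?orbT //; apply/subsetP => g.
  by rewrite !inE => /forall_inP gP; apply/forall_inP => z /(subsetP BZ)/gP.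
have : #|\bigcup_p missed (S p) (Z p) (f p)| < #|{: {ffun V -> {ffun V -> bool}}}|.
  apply: leq_ltn_trans (card_bigcup_le _) _.
  have q0 : 0 < (2 ^ t) ^ w by rewrite !expn_gt0.
  rewrite -(ltn_pmul2r q0) big_distrl.
  have le_sum := @leq_sum _ (index_enum sample) xpredT _ _ (fun p _ => miss p).
  apply: leq_ltn_trans le_sum _.
  rewrite sum_nat_const mulnA mulnC ltn_pmul2l; last first.
    by rewrite !card_ffun card_bool !expn_gt0.
  apply: leq_ltn_trans ltw; rewrite !card_prod !card_ffun card_bool !card_ord.
  by rewrite cV !mulnA.
rewrite -cardsT => ltT.
have [g gP] : exists g, g \notin \bigcup_p missed (S p) (Z p) (f p).
  apply/existsP; apply: contraLR ltT; rewrite negb_exists -leqNgt => /forallP gP.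
  by apply: subset_leq_card; apply/subsetP => g _; have := gP g; rewrite negbK.
exists V, fst, (edge g); split=> [|i A h cA]; first exact: edge_sym.
have N0 : 0 < N by rewrite /N; lia.
pose x0 : V := (i, Ordinal N0).
(* If [A] has fewer than [t] vertices, the default [x0] fills the tuple; this only enlarges the set.
   Repeated entries carry equal bits, being read from [h]. *)
pose s : {ffun 'I_t -> V} := [ffun j : 'I_t => nth x0 (enum A) j].
pose p : sample := (s, [ffun j => h (s j)], i).
have AS : A \subset S p.
  apply/subsetP => x xA; have xi : index x (enum A) < t.
    by apply: leq_trans cA; rewrite cardE index_mem mem_enum.
  apply/imsetP; exists (Ordinal xi) => //=.
  by rewrite ffunE /= nth_index ?mem_enum.
have fp x : x \in S p -> f p x = h x.
  case/imsetP=> j _ ->; apply/existsP/idP => [[k]|hj].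
    by rewrite /= !ffunE => /andP[/eqP-> ].
  by exists j; rewrite eqxx /= ffunE.
have : g \notin missed (S p) (Z p) (f p).
  by apply: contra gP => gp; apply/bigcupP; exists p.
rewrite inE negb_forall => /existsP[z]; rewrite negb_imply negbK.
rewrite !inE => /andP[/andP[zS /eqP zi] /forall_inP zP].
exists z; split=> // [|x /(subsetP AS) xS].
  by apply: contra zS; apply: (subsetP AS).
by rewrite (eqP (zP x xS)) fp.
Qed.

(** * Graphs with prescribed clique behaviour *)

Section Multipartite.
Variables (C V : finType) (col : V -> C) (r : rel V).
Hypothesis r_sym : symmetric r.

Definition mp_adj : rel V := fun x y => (col x != col y) && r x y.
Lemma mp_adj_sym : symmetric mp_adj.
Proof. by move=> x y; rewrite /mp_adj eq_sym r_sym. Qed.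
Lemma mp_adj_irr : irreflexive mp_adj.
Proof. by move=> x; rewrite /mp_adj eqxx. Qed.
Definition multipartite := Graph mp_adj_sym mp_adj_irr.

Implicit Types X : {set vertex multipartite}.

Lemma cl_col X : cl X -> {in X &, injective col}.
Proof.
move=> cX x y xX yX cxy; apply/eqP/negPn/negP => xy.
by have := cX x y xX yX xy; rewrite /= /mp_adj cxy eqxx.
Qed.

Lemma card_cl X : cl X -> #|X| <= #|C|.
Proof. by move=> /cl_col inj; rewrite -(card_in_imset inj) max_card. Qed.

Lemma transversal_maxcl X :
  cl X -> (forall i, exists2 x, x \in X & col x = i) -> maxcl X.
Proof.
move=> cX trX; split=> // -[z [zX zP]]; have [x xX cx] := trX (col z).
by have := zP x xX; rewrite /= /mp_adj cx eqxx.
Qed.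

(** A clique has at most [#|C|] vertices, so if it misses a colour, a vertex of that colour related
    to all of it extends it. *)
Lemma maxcl_transversal X :
    (forall i (S : {set V}), #|S| <= #|C| ->
      exists z, [/\ z \notin S, col z = i & forall x, x \in S -> r z x]) ->
  maxcl X -> forall i, exists2 x, x \in X & col x = i.
Proof.
move=> extr [cX maxX] i; have [/existsP[x /andP[xX /eqP cx]]|/existsPn noi] :=
  boolP [exists x, (x \in X) && (col x == i)]; first by exists x.
have [z [zX cz zP]] := extr i X (card_cl cX).
case: maxX; exists z; split=> // x xX; rewrite /= /mp_adj zP // cz andbT.
by apply: contra (noi x) => /eqP->; rewrite xX eqxx.
Qed.

End Multipartite.

Lemma generic_card (C V : finType) (col : V -> C) e t :
  C -> generic col e t -> t < #|V|.
Proof.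
move=> i gen; rewrite ltnNge -cardsT; apply/negP => /(gen i setT xpredT)[z].
by case; rewrite inE.
Qed.

Lemma avoid_image (V I : finType) (F : V -> I) (S : {set V}) :
  #|S| < #|I| -> exists i, forall x, x \in S -> F x != i.
Proof.
move=> SI; have : 0 < #|~: (F @: S)|.
  by rewrite card_setC subn_gt0 (leq_ltn_trans (leq_imset_card _ _)).
case/card_gt0P=> i; rewrite inE => iS; exists i => x xS.
by apply: contraNneq iS => <-; apply: imset_f.
Qed.

(** * Multipartite graphs with grouped colours *)

Section Grouped.
Variables (s : nat) (J V : finType) (j0 : J).
Local Notation I := 'I_s.+1.
Variables (col : V -> I * J) (e : rel V).
Hypothesis e_sym : symmetric e.
Hypothesis e_gen : generic col e (s + #|{: I * J}|).

Definition grouped_rel : rel V :=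
  fun x y => ((col x).1 == (col y).1) || e x y.
Lemma grouped_sym : symmetric grouped_rel.
Proof. by move=> x y; rewrite /grouped_rel eq_sym e_sym. Qed.
Definition grouped := multipartite col grouped_sym.

Implicit Types X : {set vertex grouped}.

(** Any [s] vertices miss one of the [s.+1] groups; adjacency between them and a vertex of that
    group is given by [e] alone. *)
Lemma grouped_ext : has_ext s grouped.
Proof.
split=> [|S T cS TS].
  by apply: leq_trans (ltnW (generic_card (ord0, j0) e_gen)); rewrite leq_addr.
have [i iS] : exists i, forall x, x \in S -> (col x).1 != i.
  by apply: avoid_image; rewrite card_ord cS.
have [|z [zS cz zP]] := e_gen (i, j0) (S := S) (mem T); first by rewrite cS leq_addr.
have adjE x : x \in S -> @adj grouped z x = (x \in T).
  move=> xS; rewrite /= /mp_adj /grouped_rel cz zP //=.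
  have xi : i != (col x).1 by rewrite eq_sym iS.
  rewrite (negPf xi) /=; case: eqVneq => [E|//].
  by rewrite -E eqxx in xi.
exists z; split=> //; split=> x; first by move=> xT; rewrite adjE ?(subsetP TS).
by case/setDP=> xS xT; rewrite adjE.
Qed.

Lemma grouped_transversal X :
  maxcl X -> forall k, exists2 x, x \in X & col x = k.
Proof.
move=> maxX; apply: maxcl_transversal maxX => k S cS.
have [|z [zS cz zP]] := e_gen k (S := S) xpredT.
  by rewrite (leq_trans cS) ?leq_addl.
by exists z; split=> // x xS; rewrite /grouped_rel zP ?orbT.
Qed.

(** With one class per group nothing is joined completely, and cliques are small enough for [e_gen]
    to find a vertex without neighbours in them. *)
Lemma grouped_phiC1 : (forall j j' : J, j = j') -> phiC1 grouped.
Proof.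
move=> J1 X cX.
have cXt : #|X| <= s + #|{: I * J}| by rewrite (leq_trans (card_cl cX)) ?leq_addl.
have [z [zX cz zP]] := e_gen (ord0, j0) xpred0 cXt.
exists z; split=> // x xX; rewrite /= /mp_adj /grouped_rel zP // orbF.
case: (col z) (col x) => [i j] [i' j'] /=; rewrite (J1 j j').
by apply/negP => /andP[/eqP + /eqP E]; rewrite E.
Qed.

(** A maximal clique meets every class, so each vertex has a neighbour in it from another class of
    its own group. *)
Lemma grouped_phiC2 : (forall j : J, exists j', j' != j) -> phiC2 grouped.
Proof.
move=> J2 X /grouped_transversal trX [z [zX zP]].
case cz: (col z) => [i j]; have [j' j'j] := J2 j; have [x xX cx] := trX (i, j').
have := zP x xX; rewrite /= /mp_adj /grouped_rel cz cx /= eqxx andbT negbK.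
by case/eqP=> E; rewrite E eqxx in j'j.
Qed.

(** With two classes per group, a clique missing the class [(i, j)] does not dominate a vertex of
    class [(i, j')] that has no [e]-neighbour in it. Hence dominating cliques are transversals. *)
Lemma grouped_phiC3 :
    (forall j : J, exists2 j', j' != j & forall k, k != j -> k = j') ->
  phiC3 grouped.
Proof.
move=> J2 X [cX domX]; apply: transversal_maxcl => // -[i j].
have [/existsP[x /andP[xX /eqP cx]]|/existsPn nok] :=
  boolP [exists x, (x \in X) && (col x == (i, j))]; first by exists x.
have cXt : #|X| <= s + #|{: I * J}| by rewrite (leq_trans (card_cl cX)) ?leq_addl.
have [j' j'j J'] := J2 j.
have [z [zX cz zP]] := e_gen (i, j') xpred0 cXt.
case: domX; exists z; split=> // x xX; rewrite /= /mp_adj /grouped_rel zP // orbF cz.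
apply/negP => /andP[+ /= /eqP E]; have := nok x; rewrite xX /=.
case: (col x) E => [i' k] /= <-; rewrite xpair_eqE eqxx /= => /J'->.
by rewrite eqxx.
Qed.

(** With three classes per group, a transversal minus one vertex still meets, for each vertex,
    another class of its group; it is dominating but not maximal. *)
Lemma grouped_not_phiC3 :
  (forall j k : J, exists2 j', j' != j & j' != k) -> ~ phiC3 grouped.
Proof.
move=> J3 C3; have [|X _ maxX] := @maxcl_exists grouped set0.
  by move=> x y; rewrite inE.
have trX := grouped_transversal maxX; case: maxX => cX _.
have [x0 x0X cx0] := trX (ord0, j0).
have [|_ []] := C3 (X :\ x0).
- split=> [x y /setD1P[_ xX] /setD1P[_ yX]|[z [zX zP]]]; first exact: cX.
  case cz: (col z) => [i j]; have [j' j'j j'j0] := J3 j j0.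
  have [x xX cx] := trX (i, j').
  have xx0 : x != x0.
    by apply: contraNneq j'j0 => E; move: cx; rewrite E cx0 => -[_ ->].
  have /zP : x \in X :\ x0 by rewrite !inE xx0.
  rewrite /= /mp_adj /grouped_rel cz cx /= eqxx andbT negbK => /eqP[E].
  by rewrite E eqxx in j'j.
- exists x0; split=> [|x /setD1P[xx0 xX]]; first by rewrite !inE eqxx.
  by apply: cX; rewrite // eq_sym.
Qed.

End Grouped.

(** * Multipartite graphs with a marked dominating clique *)

Section Marked.
Variables (s : nat) (V : finType).
Hypothesis s_gt0 : 0 < s.
Local Notation C := 'I_s.+2.
Variables (col : V -> C) (e : rel V).
Hypothesis e_sym : symmetric e.
Hypothesis e_gen : generic col e (s.+2 + s.+2).
Variable K : {set V}.
Hypothesis clK : cl (K : {set vertex (multipartite col e_sym)}).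
Hypothesis cardK : s < #|K|.

Definition undominated y := (y \notin K) && [forall k in K, ~~ mp_adj col e y k].
Definition marked_rel : rel V := fun x y =>
  [|| e x y, (x \in K) && undominated y | (y \in K) && undominated x].
Lemma marked_sym : symmetric marked_rel.
Proof. by move=> x y; rewrite /marked_rel e_sym; case: e => //=; rewrite orbC. Qed.
Definition marked := multipartite col marked_sym.

Implicit Types X : {set vertex marked}.

Lemma col_K : {in K &, injective col}.
Proof. exact: (cl_col clK). Qed.

Lemma marked_clK : cl (K : {set vertex marked}).
Proof.
move=> x y xK yK xy; have := clK xK yK xy; rewrite /= /mp_adj /marked_rel.
by case/andP=> -> ->.
Qed.

(** The added edges join an undominated vertex only to the part of [K] of other colours. This part
    is nonempty: [K] has two vertices, as [0 < s], and their colours differ. *)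
Lemma marked_dominates : ~ phiC (K : {set vertex marked}).
Proof.
move=> [z [zK zP]]; have [zu|] := boolP (undominated z); last first.
  rewrite /undominated zK /= => /forall_inPn[k kK]; rewrite negbK => zk.
  have := zP k kK; rewrite /= /mp_adj /marked_rel.
  by case/andP: zk => -> ->.
have /card_gt0P[k kK] : 0 < #|K| by apply: leq_ltn_trans cardK.
have /card_gt0P[k'] : 0 < #|K :\ k| by move: cardK; rewrite (cardsD1 k) kK; lia.
rewrite !inE => /andP[k'k k'K].
have [x xK zx] : exists2 x, x \in K & col z != col x.
  have [E|] := eqVneq (col z) (col k); last by exists k.
  exists k' => //; rewrite E; apply: contra k'k => /eqP/col_K E'.
  by rewrite E'.
have := zP x xK; rewrite /= /mp_adj /marked_rel zx xK zu.
by rewrite !orbT.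
Qed.

(** Making [z] an [e]-neighbour of [k] means that [K] already dominates [z]. So no edge is added at
    [z], and [e] alone governs its adjacency to [S]. *)
Lemma marked_fresh k i (S : {set V}) (f : V -> bool) :
    #|S| <= s.+2 -> k \in K -> k \notin S -> i != col k ->
  exists z, [/\ z \notin S :|: K, col z = i
    & forall x, x \in S -> mp_adj col marked_rel z x = (i != col x) && f x].
Proof.
move=> cS kK kS ik; have cU : #|S :|: K| <= s.+2 + s.+2.
  rewrite (leq_trans (leq_card_setU _ _)) ?leq_add //.
  by rewrite -[in leqRHS](card_ord s.+2); apply: (card_cl clK).
have [z [zU cz zP]] := e_gen i (fun x => (x == k) || f x) cU.
exists z; split=> // x xS; rewrite /mp_adj cz /marked_rel zP ?inE ?xS //.
have zK : z \notin K by apply: contra zU; rewrite inE orbC => ->.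
have zu : undominated z = false.
  apply/negP => /andP[_ /forall_inP/(_ k kK)].
  by rewrite /mp_adj cz ik zP ?eqxx // inE kK orbT.
have xk : x != k by apply: contraNneq kS => <-.
by rewrite (negPf zK) zu andbF !orbF (negPf xk).
Qed.

Lemma marked_ext : has_ext s marked.
Proof.
split=> [|S T cS TS].
  apply: leq_trans (ltnW (generic_card ord0 e_gen)).
  by rewrite -addn2 -addnA leq_addr.
have [k kK kS] : exists2 k, k \in K & k \notin S.
  have /subsetPn[k] : ~~ (K \subset S); last by exists k.
  by apply: contraL cardK => /subset_leq_card; rewrite cS -leqNgt.
(* There are [s.+2] colours, one more than the vertices to be avoided. *)
have [i iS] : exists i, forall x, x \in k |: S -> col x != i.
  by apply: avoid_image; rewrite card_ord cardsU1 kS cS.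
have cS2 : #|S| <= s.+2 by rewrite cS ltnW.
have [|z [zU cz zP]] := @marked_fresh k i S (mem T) cS2 kK kS.
  by rewrite eq_sym iS // setU11.
have adjE x : x \in S -> @adj marked z x = (x \in T).
  by move=> xS; rewrite /= zP // eq_sym iS // inE xS orbT.
exists z; split; first by apply: contra zU; rewrite inE => ->.
split=> x; first by move=> xT; rewrite adjE ?(subsetP TS).
by case/setDP=> xS xT; rewrite adjE.
Qed.

Lemma marked_not_phiC1 : ~ phiC1 marked.
Proof. by move=> /(_ K marked_clK)/marked_dominates. Qed.

(** For [k] in [K] outside [X], [marked_fresh] gives a vertex with no neighbour in [X]. *)
Lemma dominating_sub X : cl X -> ~ phiC X -> K \subset X.
Proof.
move=> cX domX; apply/subsetP => k kK; apply/negPn/negP => kX; apply: domX.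
have cXs : #|X| <= s.+2 by rewrite -[leqRHS]card_ord; apply: (card_cl cX).
have [i ik] : exists i, i != col k.
  have [|i iK] := @avoid_image C C id [set col k]; first by rewrite cards1 card_ord.
  by exists i; rewrite eq_sym iK ?inE.
have [z [zU cz zP]] := @marked_fresh k i X xpred0 cXs kK kX ik.
exists z; split=> [|x xX]; first by apply: contra zU; rewrite inE => ->.
by rewrite /= zP // andbF.
Qed.

(** A vertex outside [K] with the colour of some [k] in [K] lies in a maximal clique; this omits
    [k], so it cannot be dominating. *)
Lemma marked_not_phiC2 : ~ phiC2 marked.
Proof.
move=> C2; have /card_gt0P[k kK] : 0 < #|K| by apply: leq_ltn_trans cardK.
have cK : #|K| <= s.+2 + s.+2.
  by rewrite (leq_trans (card_cl clK)) // card_ord leq_addr.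
have [z [zK cz _]] := e_gen (col k) xpred0 cK.
have [|X zX maxX] := @maxcl_exists marked [set z].
  by move=> x y; rewrite !inE => /eqP-> /eqP->; rewrite eqxx.
have [cX _] := maxX; have /(dominating_sub cX)/subsetP KX := C2 X maxX.
have zk : z != k by apply: contraNneq zK => ->.
have := cX z k (subsetP zX z (set11 z)) (KX k kK) zk.
by rewrite /= /mp_adj cz eqxx.
Qed.

Lemma marked_phiC3 : (forall i, exists2 k, k \in K & col k = i) -> phiC3 marked.
Proof.
move=> trK X [cX /(dominating_sub cX)/subsetP KX].
apply: transversal_maxcl => // i; have [k kK ck] := trK i.
by exists k; rewrite ?KX.
Qed.

Lemma marked_not_phiC3 i : (forall k, k \in K -> col k != i) -> ~ phiC3 marked.
Proof.
move=> iK C3; have [|_ []] := C3 K.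
  by split; [exact: marked_clK | exact: marked_dominates].
have cK : #|K| <= s.+2 + s.+2.
  by rewrite (leq_trans (card_cl clK)) // card_ord leq_addr.
have [z [zK cz zP]] := e_gen i xpredT cK.
exists z; split=> // k kK; rewrite /= /mp_adj cz /marked_rel zP // andbT.
by rewrite eq_sym iK.
Qed.

End Marked.

(** * Examples for the five combinations *)

Section Existence.
Variable s : nat.

Lemma exists_phiC1 : exists G, has_ext s G /\ phiC1 G.
Proof.
have [V [col [e [e_sym gen]]]] :=
  generic_exists ('I_s.+1 * unit)%type (s + #|{: 'I_s.+1 * unit}|).
exists (grouped col e_sym); split; first exact: (grouped_ext tt).
by apply: (grouped_phiC1 tt) => // -[] [].
Qed.

Lemma exists_phiC2_phiC3 : exists G, has_ext s G /\ (phiC2 G /\ phiC3 G).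
Proof.
have [V [col [e [e_sym gen]]]] :=
  generic_exists ('I_s.+1 * bool)%type (s + #|{: 'I_s.+1 * bool}|).
exists (grouped col e_sym); split; first exact: (grouped_ext true).
split; first by apply: grouped_phiC2 => // j; exists (~~ j); case: j.
by apply: grouped_phiC3 => // j; exists (~~ j) => [|k]; case: j => //; case: k.
Qed.

Lemma exists_phiC2_not_phiC3 : exists G, has_ext s G /\ (phiC2 G /\ ~ phiC3 G).
Proof.
have J3 (j k : 'I_3) : exists2 j', j' != j & j' != k.
  have [|i iP] := @avoid_image _ 'I_3 id [set j; k].
    by rewrite card_ord cards2; case: (j != k).
  by exists i; rewrite eq_sym iP // !inE eqxx ?orbT.
have [V [col [e [e_sym gen]]]] :=
  generic_exists ('I_s.+1 * 'I_3)%type (s + #|{: 'I_s.+1 * 'I_3}|).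
exists (grouped col e_sym); split; first exact: (grouped_ext ord0).
split; last exact: (grouped_not_phiC3 ord0).
by apply: grouped_phiC2 => // j; have [j' ? _] := J3 j j; exists j'.
Qed.

Hypothesis s_gt0 : 0 < s.

(** A maximal clique of the random multipartite graph meets all [s.+2] colours and can be marked.
    Without its vertex of colour [ord0] it still has more than [s] vertices but misses a colour. *)
Lemma exists_not_phiC12 : 
  (exists G, has_ext s G /\ (~ phiC1 G /\ ~ phiC2 G /\ phiC3 G)) /\
  (exists G, has_ext s G /\ (~ phiC1 G /\ ~ phiC2 G /\ ~ phiC3 G)).
Proof.
have [V [col [e [e_sym gen]]]] := generic_exists 'I_s.+2 (s.+2 + s.+2).
have [|X _ maxX] := @maxcl_exists (multipartite col e_sym) set0.
  by move=> x y; rewrite inE.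
have trX : forall i, exists2 x, x \in X & col x = i.
  apply: maxcl_transversal maxX => i S; rewrite card_ord => cS.
  have [|z [zS cz zP]] := gen i S xpredT; first by rewrite (leq_trans cS) ?leq_addr.
  by exists z.
have [cX _] := maxX.
have cardX : s.+2 <= #|X|.
  rewrite -[leqLHS]card_ord -cardsT.
  have -> : [set: 'I_s.+2] = col @: X.
    apply/setP => i; rewrite inE; symmetry; apply/imsetP.
    by have [x xX <-] := trX i; exists x.
  exact: leq_imset_card.
split.
  have cardX' := ltnW cardX.
  exists (marked col e_sym X); split; first exact: marked_ext.
  split; first exact: marked_not_phiC1.
  by split; [exact: marked_not_phiC2 | exact: marked_phiC3].
have [x0 x0X cx0] := trX ord0.
have cK : cl (X :\ x0 : {set vertex (multipartite col e_sym)}).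
  by move=> x y /setD1P[_ xX] /setD1P[_ yX]; apply: cX.
have cardK : s < #|X :\ x0| by move: cardX; rewrite (cardsD1 x0) x0X.
exists (marked col e_sym (X :\ x0)); split; first exact: marked_ext.
split; first exact: marked_not_phiC1.
split; first exact: marked_not_phiC2.
apply: (@marked_not_phiC3 _ _ _ _ _ _ _ _ _ _ ord0) => // k /setD1P[kx0 kX].
by apply: contra kx0 => /eqP ck; apply/eqP/(cl_col cX); rewrite ?ck ?cx0.
Qed.

End Existence.

Theorem theorem4 :
  (exists s : nat, 0 < s /\
     forall G H : graph, has_ext s G -> has_ext s H ->
       (phiC1 G <-> phiC1 H) -> (phiC2 G <-> phiC2 H) -> (phiC3 G <-> phiC3 H) ->
       (phiI1 G <-> phiI1 H) -> (phiI2 G <-> phiI2 H) -> (phiI3 G <-> phiI3 H) ->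
       forall phi : form, E12 phi -> (sat_E12 G phi <-> sat_E12 H phi))
  /\
  (forall s : nat, 0 < s ->
     (exists G, has_ext s G /\ phiC1 G) /\
     (exists G, has_ext s G /\ (~ phiC1 G /\ ~ phiC2 G /\ phiC3 G)) /\
     (exists G, has_ext s G /\ (~ phiC1 G /\ ~ phiC2 G /\ ~ phiC3 G)) /\
     (exists G, has_ext s G /\ (phiC2 G /\ phiC3 G)) /\
     (exists G, has_ext s G /\ (phiC2 G /\ ~ phiC3 G)) /\
     (exists G, has_ext s G /\ phiI1 G) /\
     (exists G, has_ext s G /\ (~ phiI1 G /\ ~ phiI2 G /\ phiI3 G)) /\
     (exists G, has_ext s G /\ (~ phiI1 G /\ ~ phiI2 G /\ ~ phiI3 G)) /\
     (exists G, has_ext s G /\ (phiI2 G /\ phiI3 G)) /\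
     (exists G, has_ext s G /\ (phiI2 G /\ ~ phiI3 G))).
Proof.
split.
  (* Four is the number of vertices whose adjacencies [generic_set] prescribes at once through
     [ext4]. *)
  exists 4; split=> // G H extG extH eC1 eC2 eC3 eI1 eI2 eI3 phi phiE.
  by split; apply: E12_transfer => //; apply: iff_sym.
move=> s s_gt0.
have [G1 [ext1 P1]] := exists_phiC1 s.
have [[G2 [ext2 P2]] [G3 [ext3 P3]]] := exists_not_phiC12 s_gt0.
have [G4 [ext4 P4]] := exists_phiC2_phiC3 s.
have [G5 [ext5 P5]] := exists_phiC2_not_phiC3 s.
split; first by exists G1.
split; first by exists G2.
split; first by exists G3.
split; first by exists G4.
split; first by exists G5.
split.
  exists (complement G1); have := complement_ext ext1.
  by have [] := complement_phiI G1; tauto.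
split.
  exists (complement G2); have := complement_ext ext2.
  by have [] := complement_phiI G2; tauto.
split.
  exists (complement G3); have := complement_ext ext3.
  by have [] := complement_phiI G3; tauto.
split.
  exists (complement G4); have := complement_ext ext4.
  by have [] := complement_phiI G4; tauto.
exists (complement G5); have := complement_ext ext5.
by have [] := complement_phiI G5; tauto.
Qed.
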